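(* For all positive integers $d$, $k$, and $l$ with $k>l$, \[ \gamma(\mathbb{Z}_d,\{k,l\}) \;=\; \left\lceil \frac{d-(\delta-r)}{k+l}\right\rceil, \] where $\delta=\gcd(d,k-l)$ and $r$ is the remainder of $l\left\lceil (d-\delta)/(k+l)\right\rceil$ modulo $\delta$.
   Context: For a subset $A$ of $\mathbb{Z}_d$ and a positive integer $h$, $hA$ denotes the $h$-fold sumset $\{a_1+\cdots+a_h : a_i\in A\}$. For positive integers $k>l$, $A$ is $(k,l)$-sum-free if $kA\cap lA=\emptyset$. An arithmetic progression in $\mathbb{Z}_d$ is a set $\{a+i\cdot b : i=0,1,\dots,m-1\}$ with $m$ a positive integer, $a,b\in\mathbb{Z}_d$ and $m\le d/\gcd(d,b)$ (so it has exactly $m$ elements); when $m=1$ one takes $b=1$. $\gamma(\mathbb{Z}_d,\{k,l\})$ is the maximum size of a $(k,l)$-sum-free arithmetic progression in $\mathbb{Z}_d$ whose common difference $b$ satisfies $\gcd(b,d)=1$ (taken to be $0$ if there is none). *)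

(* Defs.v *)
From mathcomp Require Export all_boot all_order all_algebra.

Set Implicit Arguments.
Unset Strict Implicit.
Unset Printing Implicit Defensive.

Import GRing.Theory.
Local Open Scope ring_scope.

(* Z_d as a set of residues with addition mod d.  MathComp's 'Z_d is avoided
   because 'Z_1 is Z/2Z; here Zmod d has exactly d elements whenever d > 0,
   and an element coerces to its representative in {0, ..., d - 1}. *)
Notation Zmod d := 'I_d.-1.+1.

(* The summands need not be distinct. *)
Definition sumset (G : finZmodType) (h : nat) (A : {set G}) : {set G} :=
  [set \sum_(i < h) (a : {ffun 'I_h -> G}) i | a in ffun_on (mem A)].

Definition sum_free (G : finZmodType) (k l : nat) (A : {set G}) : bool :=
  [disjoint sumset k A & sumset l A].

Definition progression (G : finZmodType) (a b : G) (m : nat) : {set G} :=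
  [set a + b *+ i | i : 'I_m].

(* Letting m range over 'I_d.+1 loses nothing, as m <= d / gcd(d, b) <= d.
   The element 1 of Z_d is written [inZp 1], which also makes sense (and is 0)
   for d = 1. *)
Definition is_AP_diff (d : nat) (b : Zmod d) (A : {set Zmod d}) : bool :=
  [exists a : Zmod d, exists m : 'I_d.+1,
    [&& 0 < m, m <= d %/ gcdn d b, (m == 1 :> nat) ==> (b == inZp 1)
      & A == progression a b m]]%N.

(* The empty maximum is 0. *)
Definition gamma (d k l : nat) : nat :=
  \max_(A : {set Zmod d} |
      [exists b : Zmod d, coprime b d && is_AP_diff b A] && sum_free k l A) #|A|.

(* Main.v *)
Require Import Defs.
From mathcomp Require Import zify.

Import GRing.Theory Num.Theory.
Local Open Scope ring_scope.

(* Let delta = gcd(d, k - l).  For A = {a + i b : i <= n} with b a unit, hA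
   consists of the h a + j b with 0 <= j <= h n.  Dividing by b, A is
   sum-free iff (k - l) a / b avoids the residues of the interval [- k n, l n].
   As the elements (k - l) a / b are exactly the multiples of delta in Z_d, a
   suitable a exists iff some multiple t of delta satisfies l n < t < d - k n.
   The least multiple of delta above l n is l n + delta - (l n mod delta), so
   the condition reads (k + l) n < d - delta + (l n mod delta).  Since
   delta < k + l, with c = ceil((d - delta) / (k + l)) this holds when n < c,
   fails when n > c, and is (k + l) c < d - delta + r when n = c, where
   r = l c mod delta; it also bounds n by d, so A has exactly n + 1 elements. *)

Lemma Zmod_eqP (d m n : nat) : (0 < d)%N ->
  reflect ((inZp m : Zmod d) = inZp n) (m == n %[mod d])%N.
Proof.
move=> d_gt0; apply: (iffP eqP) => [e|/(congr1 val) /=]; last by rewrite prednK.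
by apply: val_inj; rewrite /= prednK.
Qed.

Lemma inZpD (d m n : nat) : (inZp m : Zmod d) + inZp n = inZp (m + n).
Proof. by apply: val_inj; rewrite /= modnDm. Qed.

Lemma inZp_mulrn (d m i : nat) : (inZp m : Zmod d) *+ i = inZp (m * i).
Proof.
elim: i => [|i IHi]; last by rewrite mulrS IHi inZpD mulnS.
by rewrite muln0; apply: val_inj; rewrite /= mod0n.
Qed.

(** Greedy splitting: each of the h summands takes up to n of what the earlier ones left of j. This
    realises every j <= h n as a sum of h numbers that are at most n. *)
Lemma sum_minn_subn (h n j : nat) :
  (\sum_(i < h) minn n (j - i * n) = minn (h * n) j)%N.
Proof. elim: h => [|h IHh]; rewrite ?big_ord0 ?big_ord_recr /= ?IHh; lia. Qed.

Lemma sumset_progressionP (G : finZmodType) (a b x : G) (h n : nat) :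
  reflect (exists2 j, (j <= h * n)%N & x = a *+ h + b *+ j)
          (x \in sumset h (progression a b n.+1)).
Proof.
apply: (iffP imsetP) => [[f /ffun_onP fP ->]|[j j_le ->]].
- have {}fP i : exists u : 'I_n.+1, f i == a + b *+ u.
    by case/imsetP: (fP i) => u _ ->; exists u.
  exists (\sum_(i < h) xchoose (fP i))%N.
    rewrite -[X in (_ <= X * _)%N]card_ord -sum_nat_const.
    by apply: leq_sum => i _; rewrite -ltnS.
  rewrite -sumrMnr (eq_bigr _ (fun i _ => eqP (xchooseP (fP i)))) big_split /=.
  by rewrite sumr_const card_ord.
- exists [ffun i : 'I_h => a + b *+ minn n (j - i * n)].
    apply/ffun_onP => i; rewrite ffunE; apply/imsetP.
    have lt : (minn n (j - i * n) < n.+1)%N by lia.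
    by exists (Ordinal lt).
  under eq_bigr do rewrite ffunE.
  rewrite big_split /= sumr_const card_ord sumrMnr sum_minn_subn.
  by rewrite (minn_idPr j_le).
Qed.

(** Bezout, scaled by t / gcd(d, e). It serves both to divide by a unit b and to solve (k - l) a = t
    modulo d. *)
Lemma dvdn_gcd_exists (d e t : nat) : (0 < e)%N -> (gcdn d e %| t)%N ->
  exists a, (e * a = t %[mod d])%N.
Proof.
move=> e_gt0 /dvdnP [q ->]; have [u v uv _] := egcdnP d e_gt0.
exists (u * q)%N; rewrite mulnA [(e * u)%N]mulnC uv gcdnC mulnDl [(q * _)%N]mulnC.
by rewrite mulnAC modnMDl.
Qed.

Lemma ltn_gammaP (d k l n : nat) : (0 < d)%N -> (l < k)%N ->
  reflect (exists2 t, (gcdn d (k - l) %| t)%N & (l * n < t)%N && (t + k * n < d)%N)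
          (n < gamma d k l)%N.
Proof.
move=> d_gt0 lk; have e_gt0 : (0 < k - l)%N by rewrite subn_gt0.
apply: (iffP idP) => [n_lt|[t dvd_t /andP[lt_t t_lt]]].
- have [A /andP[/existsP[b /andP[b_cop]]]] : exists2 A : {set Zmod d},
      [exists b : Zmod d, coprime b d && is_AP_diff b A] && sum_free k l A
      & (n < #|A|)%N.
    case: (pickP [pred A : {set Zmod d} |
      ([exists b : Zmod d, coprime b d && is_AP_diff b A] && sum_free k l A)
      && (n < #|A|)%N]) => [A /andP[? ?]|none]; first by exists A.
    move: n_lt; rewrite ltnNge => /negP[]; apply/bigmax_leqP => A PA.
    by have := none A; rewrite /= PA /= ltnNge => /negbFE.
  case/existsP=> a /existsP[[[|m] m_lt] /and4P[//= _ _ _ /eqP->]] free cardA.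
  have nm : (n <= m)%N.
    rewrite -ltnS; apply: (leq_trans cardA).
    by rewrite (leq_trans (leq_imset_card _ _)) // card_ord.
  have [a' a'E] : exists a', (b * a' = a %[mod d])%N.
    (* The residue 0 is coprime to d only if d = 1, and then a is 0 as well. *)
    have [b0|b_gt0] := posnP (b : nat).
      move: b_cop; rewrite b0 /coprime gcd0n => /eqP d1; exists 0.
      by congr (_ %% _)%N; have := ltn_ord a; lia.
    by apply: dvdn_gcd_exists => //; rewrite gcdnC (eqP b_cop) dvd1n.
  have aE : a = b *+ a'.
    rewrite -[b]valZpK inZp_mulrn -[LHS]valZpK.
    by apply/Zmod_eqP; rewrite // eq_sym; apply/eqP.
  (* The residue of (k - l) a / b: as b is a unit, k a + i b = l a + j b amounts to t + i = j modulo
     d. *)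
  pose t := (((k - l) * a') %% d)%N.
  have collision i j : (i <= k * m)%N -> (j <= l * m)%N -> (t + i = j %[mod d])%N ->
      False.
    move=> ik jl eq_ij; move/pred0P: free => /(_ (a *+ k + b *+ i)) /negP[].
    apply/andP; split; first by apply/sumset_progressionP; exists i.
    apply/sumset_progressionP; exists j => //.
    rewrite aE -!mulrnA -!mulrnDr -[b]valZpK !inZp_mulrn.
    apply/Zmod_eqP => //; rewrite -[X in X == _]modnMmr -[X in _ == X]modnMmr.
    apply/eqP; congr ((_ * _) %% _)%N.
    have -> : (a' * k + i = a' * l + ((k - l) * a' + i))%N by nia.
    by apply/eqP; rewrite eqn_modDl; move: eq_ij; rewrite modnDml => ->.
  have t_lt : (t < d)%N by rewrite ltn_mod.
  exists t.
    by rewrite /t /dvdn modn_dvdm ?dvdn_gcdl // -/(dvdn _ _) dvdn_mulr ?dvdn_gcdr.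
  (* If t <= l n, the pair (0, t) collides; if d - t <= k n, the pair (d - t, 0) does. Both are in
     range because n <= m. *)
  apply/andP; split; rewrite ltnNge; apply/negP => le.
    apply: (collision 0 t) => //; rewrite ?addn0 //.
    by rewrite (leq_trans le) // leq_mul2l nm orbT.
  apply: (collision (d - t)%N 0) => //; last by rewrite subnKC ?(ltnW t_lt) // modnn mod0n.
  by rewrite leq_subLR (leq_trans le) // leq_add2l leq_mul2l nm orbT.
(* Common difference 1 suffices; the first term a solves (k - l) a = t modulo d. *)
- have [a aE] := dvdn_gcd_exists _ _ _ e_gt0 dvd_t.
  have nd : (n < d)%N by nia.
  set A := progression (inZp a : Zmod d) (inZp 1) n.+1.
  have cardA : #|A| = n.+1.
    rewrite card_in_imset ?card_ord // => i j _ _ /addrI; rewrite !inZp_mulrn !mul1n.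
    move/Zmod_eqP => /(_ d_gt0); rewrite !modn_small; first by move/eqP/val_inj.
    1,2: by rewrite (leq_trans (ltn_ord _)).
  rewrite -cardA; apply: leq_bigmax_cond; apply/andP; split.
    have cop1 : coprime (inZp 1 : Zmod d) d.
      by rewrite /= prednK // coprime_modl coprime1n.
    apply/existsP; exists (inZp 1); rewrite cop1 /=.
    apply/existsP; exists (inZp a); apply/existsP.
    have n_lt : (n.+1 < d.+1)%N by [].
    exists (Ordinal n_lt); rewrite eqxx [gcdn _ _]gcdnC (eqP cop1) divn1 /=.
    by rewrite nd implybT eqxx.
  apply/pred0P => x /=; apply/negP => /andP[].
  case/sumset_progressionP => i ik -> /sumset_progressionP[j jl].
  rewrite !inZp_mulrn !mul1n.
  rewrite !inZpD => /Zmod_eqP => /(_ d_gt0).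
  (* A common element would give t + i = j modulo d; both sides are below d, yet j <= l n < t. *)
  have -> : (a * k + i = a * l + ((k - l) * a + i))%N by nia.
  rewrite eqn_modDl -modnDml aE modnDml !modn_small; lia.
Qed.

(** The quotient is the ceiling of D / S, and a ceiling exceeds n exactly when D / S does. *)
Lemma ltn_ceil_div (D S n : nat) : (0 < S)%N ->
  (n < (D + S.-1) %/ S)%N = (n * S < D)%N.
Proof. by move=> S_gt0; rewrite leq_divRL // mulSn; lia. Qed.

Lemma ceil_natr_div (D S : nat) : (0 < S)%N ->
  Num.ceil (D%:Q / S%:Q) = ((D + S.-1) %/ S)%N%:Z.
Proof.
move=> S_gt0; move N_def: (_ %/ _)%N => N.
have S_pos : 0 < S%:Q by rewrite ltr0n.
have ub : (D <= N * S)%N by rewrite leqNgt -N_def -ltn_ceil_div // ltnn.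
apply: ceil_def; rewrite ltr_pdivlMr // ler_pdivrMr //.
rewrite -!rmorphM /= ltr_int ler_int.
(* For N = 0 the truncated [N.-1] would make this bound false, while the integer bound is then just
   - S < D. *)
have : (0 < N)%N -> (N.-1 * S < D)%N by rewrite -ltn_ceil_div // N_def; lia.
by case: N ub {N_def} => [|N] ub; nia.
Qed.

Theorem theorem8 (d k l : nat) (hd : (0 < d)%N) (hk : (0 < k)%N) (hl : (0 < l)%N)
    (hkl : (l < k)%N) :
  let delta : nat := gcdn d (k - l) in
  let c : int := Num.ceil ((d%:Q - delta%:Q) / (k%:Q + l%:Q)) in
  let r : int := ((l%:Z * c) %% delta%:Z)%Z in
  (gamma d k l)%:Z = Num.ceil ((d%:Q - (delta%:Q - r%:Q)) / (k%:Q + l%:Q)).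
Proof.
move=> delta c r.
have S_gt0 : (0 < k + l)%N by lia.
have delta_gt0 : (0 < delta)%N by rewrite gcdn_gt0 hd.
have delta_d : (delta <= d)%N by rewrite dvdn_leq ?dvdn_gcdl.
have delta_lt : (delta < k + l)%N.
  have : (delta <= k - l)%N by rewrite dvdn_leq ?dvdn_gcdr ?subn_gt0.
  lia.
have SE : k%:Q + l%:Q = (k + l)%N%:Q by rewrite PoszD rmorphD.
have cE : c = ((d - delta + (k + l).-1) %/ (k + l))%N%:Z.
  by rewrite /c SE -rmorphB /= subzn // ceil_natr_div.
set C := (_ %/ _)%N in cE.
have rE : r = ((l * C) %% delta)%N%:Z by rewrite /r cE -PoszM modz_nat.
have -> : d%:Q - (delta%:Q - r%:Q) = (d - delta + (l * C) %% delta)%N%:Q.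
  by rewrite rE PoszD -subzn // [RHS]rmorphD [X in _ = X + _]rmorphB /= opprB addrA addrAC.
rewrite SE ceil_natr_div //; congr Posz.
have gammaE n : (n < gamma d k l)%N = (n * (k + l) < d - delta + (l * n) %% delta)%N.
  (* With l n = q delta + s, the multiples of delta above l n start at (q + 1) delta, which is the
     best choice of t. *)
  have := divn_eq (l * n) delta; have := ltn_pmod (l * n) delta_gt0.
  move: (_ %/ delta)%N (_ %% delta)%N => q s s_lt ln.
  apply/ltn_gammaP/idP => // [[t /dvdnP[p ->] /andP[lt1 lt2]]|lt].
    have : (q < p)%N by rewrite -(ltn_pmul2r delta_gt0); rewrite -/delta in lt1; lia.
    move=> qp; have : (q.+1 * delta <= p * delta)%N by rewrite leq_mul2r qp orbT.
    by rewrite -/delta in lt2; lia.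
  exists (q.+1 * delta)%N; first exact: dvdn_mull.
  by apply/andP; split; lia.
have eq_lt n : (n < gamma d k l)%N
    = (n < (d - delta + (l * C) %% delta + (k + l).-1) %/ (k + l))%N.
  rewrite ltn_ceil_div // gammaE.
  have r_lt m : ((l * m) %% delta < k + l)%N by rewrite (ltn_trans _ delta_lt) ?ltn_pmod.
  (* The remainders of l n and l C may differ when n is not C, but then neither affects the truth of
     its inequality. *)
  case: (ltngtP n C) => [n_lt|n_gt|->] //.
    have : (n * (k + l) < d - delta)%N by rewrite -ltn_ceil_div.
    by move=> lt; rewrite !ltn_addr.
  have ge : (d - delta <= C * (k + l))%N by rewrite leqNgt -ltn_ceil_div // ltnn.
  have big m : (n * (k + l) < d - delta + (l * m) %% delta)%N = false.
    apply: contraTF n_gt => lt; rewrite -leqNgt -ltnS -(ltn_pmul2r S_gt0) mulSn.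
    by rewrite (leq_trans lt) // addnC leq_add // ltnW.
  by rewrite !big.
(* Two naturals that exceed the same n are equal; testing n = g and n = N is enough. *)
move: (_ %/ _)%N (gamma d k l) eq_lt => N g eq_lt.
by have := eq_lt g; have := eq_lt N; rewrite !ltnn; lia.
Qed.
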